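(* Let $L>0$, $D>0$, $0<c_1<1$, and let $U_0:[L,\infty)\to\mathbb{R}$ be supported in $(L,\infty)$. Let $u$ be the exterior wave for the single-layered scattering problem with initial function $U_0$ (as defined in the context), and let $m(t)=u(L+D,t)$ be the measurement at the detector position $x=L+D$. Then $$m(t) = \frac12 U_0 (L+D+t) + \frac12 U_0 (L+D-t), \qquad 0 \leq t \leq D,$$ and for $t>D$, $$m(t) = \frac12 U_0 (L+D+t) +\frac12\,\frac{c_1 -1}{c_1 +1}\, U_0 (L-D+t) -2 c_1 \sum_{n=0}^{\left[ \frac{c_1 (t-D)}{2L}-1\right]}\frac{(c_1 -1)^n}{(c_1+1)^{n+2}}\, U_0 \left(L-D -\frac{2(n+1)L}{c_1}+t\right).$$
   Context: $[a]$ denotes the integer part (floor) of the real number $a$; a sum whose upper limit is smaller than its lower limit has no terms and equals $0$. The support assumption on $U_0$ includes $U_0(L)=0$. Single-layered scattering problem: the medium occupies $(0,L)$ with wave speed $c_1$; the exterior $x>L$ has wave speed $1$. The exterior wave $u$ and interior wave $v$ satisfy $u_{tt}-u_{xx}=0$ for $x>L$, $t>0$, with $u(x,0)=U_0(x)$, $u_t(x,0)=0$ for $x>L$; $v_{tt}-c_1^2v_{xx}=0$ for $0<x<L$, $t>0$, with $v(x,0)=v_t(x,0)=0$ for $0<x<L$ and $v(0,t)=0$ for $t>0$; and the continuity conditions $u(L,t)=v(L,t)$, $u_x(L,t)=v_x(L,t)$ for $t>0$. The solution $u$ of this problem is understood through its d'Alembert-type representation: with $G(t)=u(L,t)$ denoting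 the boundary function, $$u(x,t) = \frac{1}{2} U_0 (x+t) + \begin{cases} \tfrac{1}{2} U_0 (x-t), & x\ge L+t, \\ G (t-x+L) -\tfrac{1}{2} U_0 (t-x+2L), & L<x<L+t, \end{cases}$$ where $G:[0,\infty)\to\mathbb{R}$ is the solution of $$G(t) = \frac{c_1}{c_1 +1} U_0 (L+t) - \frac{2}{c_1 +1} \sum_{n=1}^{\left[ \frac{c_1 t}{2L}\right] } G \left( t - \frac{2n L}{c_1} \right), \qquad t\geq 0,$$ this functional equation being the (integrated) form of the two continuity conditions at $x=L$. *)

(* Defs.v *)
From mathcomp Require Export all_boot all_order all_algebra.
From mathcomp Require Export reals.

Set Implicit Arguments.
Unset Strict Implicit.
Unset Printing Implicit Defensive.

Import Order.TTheory GRing.Theory Num.Theory.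
Local Open Scope ring_scope.

(* The sum of F n for n from a up to the integer z inclusive. The upper limit
   may be negative; the filter then rejects
   every index and the sum is 0. *)
Definition sum_upto (R : realType) (a : nat) (z : int) (F : nat -> R) : R :=
  \sum_(a <= n < `|z|%N.+1 | n%:Z <= z) F n.

(* A function on [L, +oo[ is represented by a total function U0 : R -> R of
   which only the values on [L, +oo[ are ever used. The support is the set
   where U0 does not vanish, without closure, so this says U0 L = 0; the
   closed-support reading is a stronger hypothesis. *)
Definition supported_right_of (R : realType) (L : R) (U0 : R -> R) : Prop :=
  forall x, L <= x -> U0 x != 0 -> L < x.

(* The integrated form of the two continuity conditions at x = L. *)
Definition boundary_equation (R : realType) (c1 L : R) (U0 G : R -> R) : Prop :=
  forall t, 0 <= t ->
    G t = c1 / (c1 + 1) * U0 (L + t)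
          - 2 / (c1 + 1) *
            sum_upto 1 (Num.floor (c1 * t / (2 * L)))
              (fun n => G (t - 2 * n%:R * L / c1)).

(* u x t is the exterior wave, for x >= L and t >= 0, given by its d'Alembert
   representation; the boundary function G is the trace of u at x = L. *)
Definition exterior_wave (R : realType) (c1 L : R) (U0 : R -> R)
    (u : R -> R -> R) : Prop :=
  let G := fun t => u L t in
  boundary_equation c1 L U0 G /\
  forall x t, L < x -> 0 <= t ->
    u x t = 1 / 2 * U0 (x + t)
            + (if L + t <= x then 1 / 2 * U0 (x - t)
               else G (t - x + L) - 1 / 2 * U0 (t - x + 2 * L)).

Definition measurement (R : realType) (L D : R) (u : R -> R -> R) (t : R) : R :=
  u (L + D) t.

(* Main.v *)
(** Along an arithmetic progression of step [2 L / c1] the boundary equation is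
    a discrete renewal equation with constant kernel.  Subtracting consecutive
    instances turns it into the first-order recursion
    [g k.+1 = (c - 1) / (c + 1) * g k + c / (c + 1) * (f k.+1 - f k)],
    whose solution is the geometric-type sum of the theorem. *)
Require Import Defs.
From mathcomp Require Import all_boot all_order all_algebra.
From mathcomp Require Import reals.
From mathcomp Require Import ring.

Set Implicit Arguments.
Unset Strict Implicit.
Unset Printing Implicit Defensive.

Import Order.TTheory GRing.Theory Num.Theory.
Local Open Scope ring_scope.

Lemma sum_upto_nat (R : realType) (a k : nat) (F : nat -> R) :
  sum_upto a k F = \sum_(a <= n < k.+1) F n.
Proof.
rewrite /sum_upto absz_nat [RHS]big_nat_cond [LHS]big_nat_cond.
by apply: eq_bigl => n; rewrite lez_nat andbT -andbA andbb.
Qed.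

Lemma sum_upto_pred (R : realType) (k : nat) (F : nat -> R) :
  sum_upto 0 (k%:Z - 1) F = \sum_(0 <= n < k) F n.
Proof.
case: k => [|k]; last by rewrite -addn1 PoszD addrK sum_upto_nat addn1.
(* For [k = 0] the limit is [-1], whose absolute value keeps the indices 0 and 1 in range; only the
   filter empties the sum. *)
by rewrite /sum_upto big_pred0 ?big_geq // => n; rewrite sub0r lerNr.
Qed.

(** As the kernel is constant, the sum at [k.+1] is [g k] plus the whole sum at [k], so the history
    cancels; the factor of [g k] is [1 - 2 / (c + 1)]. *)
Lemma renewal_rec (F : fieldType) (c : F) (g f : nat -> F) :
  c + 1 != 0 ->
  (forall k, g k = c / (c + 1) * f k
                   - 2 / (c + 1) * \sum_(1 <= n < k.+1) g (k - n)%N) ->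
  forall k, g k.+1 = (c - 1) / (c + 1) * g k + c / (c + 1) * (f k.+1 - f k).
Proof.
move=> c1 gE k; rewrite (gE k.+1) big_nat_recl //=.
under eq_bigr do rewrite subSS.
rewrite subSS subn0 (gE k); by field.
Qed.

(** In the induction the factor [(c - 1) / (c + 1)] carries the [n]-th coefficient to the next one,
    while [f k] receives [c / (c + 1) * ((c - 1) / (c + 1) - 1) = - 2 * c / (c + 1) ^+ 2], the new
    term [n = 0]. *)
Lemma renewal_solution (F : fieldType) (c : F) (g f : nat -> F) :
  c + 1 != 0 ->
  (forall k, g k = c / (c + 1) * f k
                   - 2 / (c + 1) * \sum_(1 <= n < k.+1) g (k - n)%N) ->
  forall k, g k = c / (c + 1) * f k
    - 2 * c * \sum_(0 <= n < k)
                (c - 1) ^+ n / (c + 1) ^+ (n + 2) * f (k - n.+1)%N.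
Proof.
move=> c1 gE; elim=> [|k IHk]; first by rewrite gE !big_geq ?mulr0.
rewrite (renewal_rec c1 gE) IHk big_nat_recl //.
rewrite [in RHS](eq_bigr (fun n => (c - 1) / (c + 1) *
  ((c - 1) ^+ n / (c + 1) ^+ (n + 2) * f (k - n.+1)%N))); last first.
  move=> n _; rewrite subSS addSn !exprS; field.
  by rewrite c1 expf_neq0.
rewrite -mulr_sumr subn1 /= expr0 add0n.
by field.
Qed.

Lemma boundary_solution (R : realType) (c1 L : R) (U0 G : R -> R) :
  0 < L -> 0 < c1 -> boundary_equation c1 L U0 G ->
  forall s, 0 <= s ->
    G s = c1 / (c1 + 1) * U0 (L + s)
      - 2 * c1 * sum_upto 0 (Num.floor (c1 * s / (2 * L) - 1))
          (fun n => (c1 - 1) ^+ n / (c1 + 1) ^+ (n + 2)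
                    * U0 (L + s - 2 * (n%:R + 1) * L / c1)).
Proof.
move=> L0 c0 GE s s0.
have cn : c1 != 0 by rewrite gt_eqF.
have Ln : L != 0 by rewrite gt_eqF.
have c1n : c1 + 1 != 0 by rewrite gt_eqF // addr_gt0.
have y0 : 0 <= c1 * s / (2 * L) by rewrite divr_ge0 ?mulr_ge0 // ltW.
have [k kE] : exists k : nat, Num.floor (c1 * s / (2 * L)) = k%:Z.
  have : 0 <= Num.floor (c1 * s / (2 * L)) by rewrite floor_ge0.
  by case: (Num.floor _) => // k _; exists k.
(* [rho] is the remainder of [s] modulo the step [tau], with quotient [k]: the progression starts at
   [rho], still a nonnegative time, and reaches [s] at index [k]. *)
pose tau := 2 * L / c1; pose rho := s - k%:R * tau.
have rho0 : 0 <= rho.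
  have := floor_le (c1 * s / (2 * L)); rewrite kE => h.
  rewrite subr_ge0 /tau mulrA ler_pdivrMr //.
  by move: h; rewrite ler_pdivlMr ?mulr_gt0 // [s * _]mulrC.
have tau0 : 0 < tau by rewrite divr_gt0 // mulr_gt0.
have gE j : G (rho + j%:R * tau) = c1 / (c1 + 1) * U0 (L + (rho + j%:R * tau))
    - 2 / (c1 + 1) *
      \sum_(1 <= n < j.+1) G (rho + (j - n)%N%:R * tau).
  rewrite GE; last by rewrite addr_ge0 // mulr_ge0 // ltW.
  (* One step [tau] raises the argument of the floor by exactly 1, so at index [j] the floor is [j].
     The shift from [s] may be negative, hence the integer [j%:Z - k%:Z]. *)
  have -> : c1 * (rho + j%:R * tau) / (2 * L)
            = c1 * s / (2 * L) + (j%:Z - k%:Z)%:~R.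
    rewrite intrB -!pmulrn /rho /tau; field; by rewrite Ln cn.
  rewrite floorDrz ?intr_int // kE intrKfloor subrKC sum_upto_nat.
  congr (_ - _ * _); apply: eq_big_nat => n /andP[_ nj].
  congr G; rewrite natrB // /tau; by field.
have sE : s = rho + k%:R * tau by rewrite /rho subrK.
have := renewal_solution (g := fun j => G (rho + j%:R * tau))
  (f := fun j => U0 (L + (rho + j%:R * tau))) c1n gE k.
rewrite -sE => ->.
rewrite (_ : -1 = (-1 : int)%:~R) // floorDrz ?intr_int // kE intrKfloor.
rewrite sum_upto_pred; congr (_ - _ * _); apply: eq_big_nat => n /andP[_ nk].
congr (_ * U0 _); rewrite natrB // /rho /tau -natr1; by field.
Qed.

Theorem proposition2p3 (R : realType) (L D c1 : R) (U0 : R -> R)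
    (u : R -> R -> R)
    (hL : 0 < L) (hD : 0 < D) (hc1 : 0 < c1 < 1)
    (hU0 : supported_right_of L U0)
    (hu : exterior_wave c1 L U0 u) :
  (forall t, 0 <= t <= D ->
     measurement L D u t = 1 / 2 * U0 (L + D + t) + 1 / 2 * U0 (L + D - t)) /\
  (forall t, D < t ->
     measurement L D u t =
       1 / 2 * U0 (L + D + t)
       + 1 / 2 * ((c1 - 1) / (c1 + 1)) * U0 (L - D + t)
       - 2 * c1 *
         sum_upto 0 (Num.floor (c1 * (t - D) / (2 * L) - 1))
           (fun n => (c1 - 1) ^+ n / (c1 + 1) ^+ (n + 2)
                     * U0 (L - D - 2 * (n%:R + 1) * L / c1 + t))).
Proof.
have [c0 _] := andP hc1; have [GE uE] := hu.
have xL : L < L + D by rewrite ltrDl.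
split=> t => [/andP[t0 tD]|Dt].
  by rewrite /measurement uE // lerD2l tD.
have t0 : 0 <= t by apply: ltW (lt_trans hD Dt).
(* The detector sees the boundary value delayed by the travel time [D]. *)
rewrite /measurement uE // lerD2l leNgt Dt /= (_ : t - (L + D) + L = t - D); last by ring.
rewrite (boundary_solution hL c0 GE); last by rewrite subr_ge0 ltW.
rewrite (_ : t - (L + D) + 2 * L = L - D + t); last by ring.
rewrite (_ : L + (t - D) = L - D + t); last by ring.
rewrite /sum_upto; under [in RHS]eq_bigr do rewrite addrAC.
(* The two multiples of [U0 (L - D + t)] merge by [c1 / (c1 + 1) - 1 / 2 = 1 / 2 * ((c1 - 1) / (c1 +
   1))]. *)
field.
by rewrite gt_eqF // addr_gt0.
Qed.
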